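(* Let $G=(V,E,\{c_e\}_{e\in E})$ be a finite undirected graph with positive edge conductances, each edge oriented arbitrarily, and let $w\in\mathbb{R}^E$ be a nonzero vector. Define the probability vector $\mu_w\in\mathbb{R}^V_{\ge0}$ by $$\mu_w(x):=\frac{1}{2\|w\|_2^2}\sum_{e:\,x\in e}w_e^2.$$ Let $\Pi:=C^{1/2}BL^+B^\top C^{1/2}$ and let $\overline{\Pi}$ be its entrywise absolute value. Then $$\left|w^\top\overline{\Pi}w\right|\le 2H(\mu_w)\|w\|_2^2,$$ where $H(\mu)=-\sum_x\mu(x)\log\mu(x)$ is the (natural-log) entropy, with $0\log0=0$.
   Context: For a vertex $v$, $\mathbbm{1}_v\in\mathbb{R}^V$ is the standard basis vector. For an edge $e$ oriented from $e^-$ to $e^+$, $b_e:=\mathbbm{1}_{e^+}-\mathbbm{1}_{e^-}$; $B\in\mathbb{R}^{E\times V}$ is the matrix with row $b_e^\top$ for each $e$. $C=\operatorname{diag}(c_e)_{e\in E}$, $L:=B^\top CB$ is the weighted Laplacian, and $L^+$ is its Moore–Penrose pseudoinverse. The sum $\sum_{e:x\in e}$ ranges over edges incident to $x$. Graphs have no self-loops; parallel edges are allowed. *)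

(* Defs.v *)
From HB Require Import structures.
From mathcomp Require Import all_boot all_order all_algebra.
From mathcomp Require Import reals exp.
Set Implicit Arguments. Unset Strict Implicit. Unset Printing Implicit Defensive.
Import Order.TTheory GRing.Theory Num.Theory.
Local Open Scope ring_scope.

(* A finite multigraph with vertex set 'I_n and edge set 'I_m; edge e is
   oriented from [src e] (= e^-) to [tgt e] (= e^+). *)
Section Graph.
Variable R : realType.
Variables (n m : nat) (src tgt : 'I_m -> 'I_n).

Definition incidence : 'M[R]_(m, n) :=
  \matrix_(e < m, v < n) ((v == tgt e)%:R - (v == src e)%:R).

Definition cond_mx (c : 'I_m -> R) : 'M[R]_m := \matrix_(e, f) ((e == f)%:R * c e).
Definition sqrt_cond_mx (c : 'I_m -> R) : 'M[R]_m :=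
  \matrix_(e, f) ((e == f)%:R * Num.sqrt (c e)).

Definition laplacian (c : 'I_m -> R) : 'M[R]_n :=
  (incidence)^T *m cond_mx c *m incidence.

Definition is_MP_pinv (k : nat) (A X : 'M[R]_k) : Prop :=
  [/\ A *m X *m A = A, X *m A *m X = X,
      (A *m X)^T = A *m X & (X *m A)^T = X *m A].

Definition Pi_mx (c : 'I_m -> R) (Lp : 'M[R]_n) : 'M[R]_m :=
  sqrt_cond_mx c *m incidence *m Lp *m (incidence)^T *m sqrt_cond_mx c.

Definition abs_mx (k l : nat) (A : 'M[R]_(k, l)) : 'M[R]_(k, l) :=
  \matrix_(i, j) `|A i j|.

Definition sqnorm (w : 'cV[R]_m) : R := \sum_(e < m) w e 0 ^+ 2.

Definition mu_w (w : 'cV[R]_m) (x : 'I_n) : R :=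
  (2 * sqnorm w)^-1 * \sum_(e < m | (src e == x) || (tgt e == x)) w e 0 ^+ 2.

End Graph.

Definition entropy (R : realType) (k : nat) (mu : 'I_k -> R) : R :=
  - \sum_(x < k) (if mu x == 0 then 0 else mu x * ln (mu x)).

(* Main.v *)
(* The pseudo-inverse is an integral of a heat flow that may be run with respect
   to any positive vertex measure pi: for d > 0 and P = (pi + d L)^-1 pi (one
   implicit Euler step), L^+ agrees on edge vectors with d times the sum over
   k >= 1 of the kernels K_k = P^k pi^-1.  Splitting K_(i+j) = K_i pi K_j and
   using Cauchy-Schwarz bounds the quadratic form by the sum over k and z of
   pi(z) (sum_e |w_e| sqrt(c_e) |grad_e K_k(., z)|)^2.  The logarithmic mean is at
   most the arithmetic one, so the square is at most
     |w|^2 (sum_x mu_w(x) K_k(x, z)) * energy (K_k(., z)) (ln K_k(., z)),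
   in which the energy is the entropy dissipated in one step.  For pi = mu_w the
   first sum is the total mass 1, and the dissipation started from
   the point mass at z adds up to at most - ln pi(z); averaging over z against pi
   gives H(mu_w).  As mu_w may vanish at some vertices, take pi = mu_w + s^2
   and let s tend to 0 at the end. *)
Require Import Defs.
From HB Require Import structures.
From mathcomp Require Import all_boot all_order all_algebra ring lra.
From mathcomp Require Import reals topology normedtype derive realfun exp.
Import Order.TTheory GRing.Theory Num.Theory numFieldNormedType.Exports.
Set Implicit Arguments. Unset Strict Implicit. Unset Printing Implicit Defensive.
Local Open Scope ring_scope.

(** * Scalar inequalities for the logarithm, and a Cauchy-Schwarz inequality *)

Lemma ln_ge_cayley (R : realType) (t : R) : 1 <= t ->
  2 * (t - 1) <= (t + 1) * ln t.
Proof.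
move=> t1; have t_gt0 : 0 < t := lt_le_trans ltr01 t1.
(* The claim is f 1 = 2 <= f t multiplied by t + 1; the derivative of f is (x - 1)^2 / (x (x +
   1)^2). *)
pose f (x : R) := ln x + 4 *: (x + 1)^-1.
have df (x : R) : 1 <= x -> is_derive x 1 f (x^-1 - 4 * (x + 1) ^- 2).
  move=> x1; have x0 : x + 1 != 0 by apply/negP => /eqP; lra.
  have := @is_derive1_ln R x ltac:(lra) => dl.
  rewrite -mulrN; apply: is_deriveD; apply: is_deriveZ.
  apply: is_derive_eq; rewrite [_ *: _]/GRing.scale /=; field.
  exact: x0.
suff : f 1 <= f t.
  rewrite /f ln1 add0r ![_ *: _]/GRing.scale /= => ft.
  have t1n : t + 1 != 0 by apply/negP => /eqP; lra.
  have -> : 2 * (t - 1) = (t + 1) * (4 * (1 + 1)^-1 - 4 * (t + 1)^-1) by field.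
  rewrite ler_wpM2l; lra.
apply: (@ger0_derive1_ndecr R f 1 t) => // [x|x|].
- by rewrite in_itv /= => /andP[x1 _]; have [] := df x (ltW x1).
- rewrite in_itv /= => /andP[x1 _]; rewrite derive1E.
  have [_ ->] := df x (ltW x1).
  have x0 : x != 0 by apply/negP => /eqP; lra.
  have x10 : x + 1 != 0 by apply/negP => /eqP; lra.
  have -> : x^-1 - 4 * (x + 1) ^- 2 = (x - 1) ^+ 2 * (x^-1 * (x + 1) ^- 2).
    by field; rewrite x0 x10.
  rewrite mulr_ge0 ?sqr_ge0 // mulr_ge0 ?invr_ge0 ?sqr_ge0 //; lra.
- apply: derivable_within_continuous => x; rewrite in_itv /= => /andP[x1 _].
  by have [] := df x x1.
Qed.

(* The logarithmic mean is at most the arithmetic mean. *)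
Lemma sqr_sub_le_ln (R : realType) (a b : R) : 0 < a -> 0 < b ->
  (a - b) ^+ 2 <= (a + b) / 2 * ((a - b) * (ln a - ln b)).
Proof.
wlog ab : a b / b <= a => [H a0 b0|a0 b0].
  have [/H|/ltW /H] := leP b a; first exact.
  move=> /(_ b0 a0); congr (_ <= _); ring.
have := @ln_ge_cayley R (a / b) ltac:(by rewrite ler_pdivlMr ?mul1r).
rewrite ln_div ?posrE // => h.
have {h} : 2 * (a - b) <= (a + b) * (ln a - ln b).
  rewrite -(ler_pM2l b0) in h; have bn : b != 0 by rewrite gt_eqF.
  have -> : 2 * (a - b) = b * (2 * (a / b - 1)) by field.
  by apply: (le_trans h); rewrite le_eqVlt; apply/orP; left; apply/eqP; field.
move=> h; have : 0 <= a - b by lra.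
move=> /(ler_wpM2l) /(_ _ _ h); nra.
Qed.

(** By convexity x ln x lies above its tangent at b; for a > 0 this is ln (b / a) <= b / a - 1
    multiplied by a. *)
Lemma xlnx_tangent (R : realType) (a b : R) : 0 <= a -> 0 < b ->
  b * ln b + (1 + ln b) * (a - b) <= a * ln a.
Proof.
rewrite le_eqVlt => /predU1P[<- b0|a0 b0]; first by rewrite mul0r; nra.
have := @le_ln1Dx R (b / a - 1) ltac:(by rewrite ltrBrDr addNr divr_gt0).
rewrite addrCA subrr addr0 ln_div ?posrE // -(ler_pM2l a0).
have -> : a * (b / a - 1) = b - a by field; rewrite gt_eqF.
by move=> h; nra.
Qed.

(** Follows from ln (1/s) < 1/s. It makes the cost of shifting a measure by s^2 linear in s. *)
Lemma sqr_xlnx_ge (R : realType) (s : R) : 0 < s -> - (s ^+ 2 * ln (s ^+ 2)) <= 2 * s.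
Proof.
move=> s0; rewrite lnXn // mulr2n.
have := @ln_sublinear R s^-1 ltac:(by rewrite invr_gt0).
rewrite lnV ?posrE // -(ltr_pM2l s0) mulfV ?gt_eqF // => h; nra.
Qed.

(** Square roots are avoided by asking only that |x_i| be at most the geometric mean of a_i and
    b_i. *)
Lemma CauchySchwarz_sum (R : realType) (I : Type) (r : seq I) (x a b : I -> R) :
  (forall i, 0 <= a i) -> (forall i, 0 <= b i) ->
  (forall i, x i ^+ 2 <= a i * b i) ->
  (\sum_(i <- r) x i) ^+ 2 <= (\sum_(i <- r) a i) * \sum_(i <- r) b i.
Proof.
move=> a0 b0 xab.
elim: r => [|i r IH]; first by rewrite !big_nil expr0n mulr0.
rewrite !big_cons.
have A0 : 0 <= \sum_(j <- r) a j by rewrite sumr_ge0.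
have B0 : 0 <= \sum_(j <- r) b j by rewrite sumr_ge0.
move: IH A0 B0 (xab i) (a0 i) (b0 i).
move: (\sum_(j <- r) x j) (\sum_(j <- r) a j) (\sum_(j <- r) b j) => X A B.
move: (x i) (a i) (b i) => y c d IH A0 B0 h c0 d0.
(* The cross term is bounded by AM-GM: (2 X y)^2 <= 4 (A d) (c B) <= (A d + c B)^2. *)
suff cross : 2 * (X * y) <= A * d + c * B.
  by lra.
have P0 : 0 <= A * d + c * B by rewrite addr_ge0 ?mulr_ge0.
apply: le_trans (ler_norm _) _; rewrite -ler_sqr ?nnegrE // real_normK ?num_real //.
apply: le_trans (_ : 4 * ((A * B) * (c * d)) <= _).
  have -> : (2 * (X * y)) ^+ 2 = 4 * (X ^+ 2 * y ^+ 2) by ring.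
  by rewrite ler_wpM2l //; apply: ler_pM; rewrite ?sqr_ge0.
rewrite -subr_ge0.
have -> : (A * d + c * B) ^+ 2 - 4 * (A * B * (c * d)) = (A * d - c * B) ^+ 2.
  by ring.
exact: sqr_ge0.
Qed.

(** * One implicit Euler step: maximum principles, dissipation of entropy and energy *)

Section HeatFlow.
Variables (R : realType) (n m : nat) (src tgt : 'I_m -> 'I_n).
Variables (c : 'I_m -> R) (pi : 'I_n -> R) (d : R).
Implicit Types p q f g phi : 'I_n -> R.

Definition edge_diff f (e : 'I_m) : R := f (tgt e) - f (src e).

Local Notation grad := edge_diff.

(** The Dirichlet form f^T L g, see [sum_laplacian]. *)
Definition energy f g : R := \sum_e c e * (grad f e * grad g e).

(** Minus the entropy of the density f relative to pi, so it decreases along the flow. *)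
Definition ent f : R := \sum_x pi x * (f x * ln (f x)).

(* Weak form of one implicit Euler step [pi (q - p) = - d L q]. *)
Definition heat_step p q : Prop := forall phi,
  \sum_x pi x * q x * phi x + d * energy q phi = \sum_x pi x * p x * phi x.

Hypotheses (c_gt0 : forall e, 0 < c e) (pi_gt0 : forall x, 0 < pi x).
Hypothesis d_gt0 : 0 < d.

Lemma energy_ge0 f : 0 <= energy f f.
Proof. by apply: sumr_ge0 => e _; rewrite -expr2 mulr_ge0 ?sqr_ge0 // ltW. Qed.

(** Test against h = min (q, 0). Truncation is monotone, so the energy term is nonnegative, while
    the right side is nonpositive; hence the sum of pi h^2 vanishes. *)
Lemma heat_step_ge0 p q : heat_step p q ->
  (forall x, 0 <= p x) -> forall x, 0 <= q x.
Proof.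
move=> pq p0; pose h x := Num.min (q x) 0.
have h_le0 x : h x <= 0 by rewrite /h ge_min lexx orbT.
have qh x : q x * h x = h x ^+ 2.
  by rewrite /h; case: (leP (q x) 0) => _; rewrite ?expr2 // mulr0 mul0r.
have E0 : 0 <= energy q h.
  apply: sumr_ge0 => e _; apply: mulr_ge0; [exact: ltW | rewrite /edge_diff /h].
  move: (q (tgt e)) (q (src e)) => a b.
  case: (leP a 0) => a0; case: (leP b 0) => b0.
  - by rewrite -expr2 sqr_ge0.
  - by have := mulr_le0_ge0 a0 (ltW b0); have := sqr_ge0 a; lra.
  - by have := mulr_ge0_le0 (ltW a0) b0; have := sqr_ge0 b; lra.
  - by rewrite subrr mulr0.
have : \sum_x pi x * h x ^+ 2 <= 0.
  have -> : \sum_x pi x * h x ^+ 2 = \sum_x pi x * q x * h x.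
    by apply: eq_bigr => x _; rewrite -mulrA qh.
  have : \sum_x pi x * p x * h x <= 0.
    by apply: sumr_le0 => x _; rewrite mulr_ge0_le0 ?mulr_ge0 // ltW.
  have := pq h; have : 0 <= d * energy q h by rewrite mulr_ge0 // ltW.
  lra.
have t0 x : 0 <= pi x * h x ^+ 2 by rewrite mulr_ge0 ?sqr_ge0 // ltW.
move=> s0 x; have s0' : \sum_x pi x * h x ^+ 2 = 0.
  by apply/eqP; rewrite eq_le s0 sumr_ge0.
have /eqP := s0'; rewrite psumr_eq0; last by move=> ? _; exact: t0.
move=> /allP/(_ x (mem_index_enum x)) /=.
rewrite mulf_eq0 gt_eqF //= sqrf_eq0 /h.
by case: (leP (q x) 0) => [_ /eqP ->|/ltW].
Qed.

(** Strong maximum principle, by testing against the indicator of q = 0: the energy term is at most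
    0 and the right side at least 0, so every summand vanishes. Thus ln 0 is never compared across
    an edge with the logarithm of a positive value. *)
Lemma heat_step_eq0 p q : heat_step p q -> (forall x, 0 <= p x) ->
  (forall x, q x = 0 -> p x = 0) /\
  (forall e, (q (src e) == 0) = (q (tgt e) == 0)).
Proof.
move=> pq p0; have q0 := heat_step_ge0 pq p0.
pose h x : R := (q x == 0)%:R.
have t_le0 e : c e * (grad q e * grad h e) <= 0.
  apply: mulr_ge0_le0; [exact: ltW | rewrite /edge_diff /h].
  by have [->|_] := eqVneq (q (src e)) 0; have [->|_] := eqVneq (q (tgt e)) 0;
    have := q0 (src e); have := q0 (tgt e); rewrite /= ?mulr1n ?mulr0n; lra.
have s_ge0 x : 0 <= pi x * p x * h x.
  by rewrite !mulr_ge0 // ?ler0n // ltW.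
have qh : \sum_x pi x * q x * h x = 0.
  apply: big1 => x _; rewrite /h; have [->|_] := eqVneq (q x) 0; last by rewrite mulr0.
  by rewrite mulr0 mul0r.
have := pq h; rewrite qh add0r => Eh.
have E_le0 : energy q h <= 0 by apply: sumr_le0.
have S_ge0 : 0 <= \sum_x pi x * p x * h x by apply: sumr_ge0.
have E0 : energy q h = 0.
  apply/eqP; rewrite eq_le E_le0 -(pmulr_rge0 _ d_gt0) Eh //.
move: Eh; rewrite E0 mulr0 => /esym/eqP S0; split.
- move: S0; rewrite psumr_eq0 // => /allP S0 x qx0.
  have := S0 x (mem_index_enum x); rewrite /h qx0 eqxx mulr1 mulf_eq0 gt_eqF //=.
  by move/eqP.
- move/eqP: E0; rewrite /energy -oppr_eq0 -sumrN psumr_eq0; last first.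
    by move=> e _; rewrite oppr_ge0.
  move=> /allP E0 e; have := E0 e (mem_index_enum e).
  rewrite oppr_eq0 mulf_eq0 gt_eqF //= /edge_diff /h.
  have [->|qs] := eqVneq (q (src e)) 0; have [->|qt] := eqVneq (q (tgt e)) 0 => //.
    by rewrite subr0 sub0r mulrN1 oppr_eq0 (negPf qt).
  by rewrite subr0 mulr1 sub0r oppr_eq0 (negPf qs).
Qed.

Lemma heat_step_mass p q : heat_step p q ->
  \sum_x pi x * q x = \sum_x pi x * p x.
Proof.
move=> /(_ (fun=> 1)).
have -> : energy q (fun=> 1) = 0.
  by apply: big1 => e _; rewrite /edge_diff subrr !mulr0.
rewrite mulr0 addr0.
by under eq_bigr do rewrite mulr1; under [RHS]eq_bigr do rewrite mulr1.
Qed.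

(* By convexity of x ln x the implicit step dissipates entropy without any
   time-discretisation error. *)
Lemma heat_step_ent p q : heat_step p q -> (forall x, 0 <= p x) ->
  d * energy q (fun x => ln (q x)) <= ent p - ent q.
Proof.
move=> pq p0; have q0 := heat_step_ge0 pq p0.
have [qp0 _] := heat_step_eq0 pq p0.
have mass := heat_step_mass pq.
(* The step is tested against ln q; the added mass difference sums to zero and completes each term
   to the linear part of the tangent inequality at q x. *)
have -> : d * energy q (fun x => ln (q x)) = \sum_x
    ((pi x * p x * ln (q x) - pi x * q x * ln (q x)) + (pi x * p x - pi x * q x)).
  by rewrite big_split /= !sumrB mass subrr addr0 -pq [X in X - _]addrC addrK.
rewrite /ent -sumrB; apply: ler_sum => x _.
have [qx0|qx0] := eqVneq (q x) 0.
  by rewrite (qp0 x qx0) qx0 !(mulr0, mul0r, subr0, addr0).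
have qx_gt0 : 0 < q x by rewrite lt_neqAle eq_sym qx0 q0.
by have := ler_wpM2l (ltW (pi_gt0 x)) (xlnx_tangent (p0 x) qx_gt0); lra.
Qed.

(** Jensen: the tangent inequality is summed at the constant density 1/V, where the linear part
    cancels because f has mass 1. *)
Lemma ent_ge f : (forall x, 0 <= f x) -> \sum_x pi x * f x = 1 ->
  - ln (\sum_x pi x) <= ent f.
Proof.
move=> f0 mass; set V := \sum_x pi x.
have V0 : 0 <= V by apply: sumr_ge0 => x _; rewrite ltW.
have Vn : V != 0.
  apply/eqP => V00; have /eqP := V00.
  rewrite psumr_eq0 => [/allP V_|x _]; last by rewrite ltW.
  move/eqP: mass; rewrite big1 ?(eq_sym 0) ?oner_eq0 // => x _.
  by have /= /eqP -> := V_ x (mem_index_enum x); rewrite mul0r.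
have Vgt0 : 0 < V by rewrite lt_neqAle eq_sym Vn.
have Vi : 0 < V^-1 by rewrite invr_gt0.
have : \sum_x pi x * (V^-1 * ln V^-1 + (1 + ln V^-1) * (f x - V^-1)) <= ent f.
  apply: ler_sum => x _; apply: ler_wpM2l; first exact: ltW.
  exact: xlnx_tangent.
apply: le_trans.
have -> : \sum_x pi x * (V^-1 * ln V^-1 + (1 + ln V^-1) * (f x - V^-1)) =
   V * (V^-1 * ln V^-1) + (1 + ln V^-1) * (\sum_x pi x * f x - V * V^-1).
  rewrite /V !mulr_suml mulrBr !mulr_sumr -sumrB -big_split /=.
  apply: eq_bigr => x _; ring.
by rewrite mass mulfV // subrr mulr0 addr0 mulrA mulfV // mul1r lnV ?posrE.
Qed.

(** Test against q and use 2 q (p - q) <= p^2 - q^2. *)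
Lemma heat_step_norm p q : heat_step p q ->
  2 * d * energy q q <= \sum_x pi x * p x ^+ 2 - \sum_x pi x * q x ^+ 2.
Proof.
move=> /(_ q) pq.
have -> : 2 * d * energy q q =
    2 * (\sum_x pi x * p x * q x - \sum_x pi x * q x * q x) by rewrite -pq; lra.
rewrite -!sumrB mulr_sumr; apply: ler_sum => x _.
have : 0 <= pi x * (p x - q x) ^+ 2 by rewrite mulr_ge0 ?sqr_ge0 // ltW.
lra.
Qed.

(** Testing against q - p gives d E(q, q - p) = - sum pi (q - p)^2 <= 0, and by convexity E(q, q) -
    E(p, p) <= 2 E(q, q - p). *)
Lemma heat_step_energy p q : heat_step p q -> energy q q <= energy p p.
Proof.
move=> /(_ (fun x => q x - p x)) pq.
have E1 : energy q (fun x => q x - p x) <= 0.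
  rewrite -(pmulr_rle0 _ d_gt0).
  have -> : d * energy q (fun x => q x - p x) =
      - \sum_x pi x * (q x - p x) ^+ 2.
    move: pq => /(canRL (addKr _)) ->; rewrite addrC -sumrB -sumrN.
    by apply: eq_bigr => x _; ring.
  by rewrite oppr_le0; apply: sumr_ge0 => x _; rewrite mulr_ge0 ?sqr_ge0 // ltW.
have : energy q q - energy p p <= 2 * energy q (fun x => q x - p x).
  rewrite -sumrB mulr_sumr; apply: ler_sum => e _.
  have : 0 <= c e * (grad q e - grad p e) ^+ 2 by rewrite mulr_ge0 ?sqr_ge0 // ltW.
  rewrite /edge_diff; lra.
lra.
Qed.

Lemma grad_mul_ln_ge0 q e : (forall x, 0 <= q x) ->
  (q (src e) == 0) = (q (tgt e) == 0) ->
  0 <= grad q e * grad (fun x => ln (q x)) e.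
Proof.
move=> q0 qz; have [qs|qs] := eqVneq (q (src e)) 0.
  have /eqP qt : q (tgt e) == 0 by rewrite -qz qs.
  by rewrite /edge_diff qs qt subrr mul0r.
have s0 : 0 < q (src e) by rewrite lt_neqAle eq_sym qs q0.
have t0 : 0 < q (tgt e) by rewrite lt_neqAle eq_sym -qz qs q0.
have a1 : 0 < (q (tgt e) + q (src e)) / 2 by rewrite divr_gt0 ?addr_gt0.
rewrite -(pmulr_rge0 _ a1); apply: le_trans (sqr_sub_le_ln t0 s0).
exact: sqr_ge0.
Qed.

(** Cauchy-Schwarz over edges: [sqr_sub_le_ln] splits |grad q|^2 into the endpoint average of q,
    taken with w_e^2, and the entropy dissipation, taken with c_e. *)
Lemma sqr_sum_grad_le (w : 'I_m -> R) q : (forall x, 0 <= q x) ->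
  (forall e, (q (src e) == 0) = (q (tgt e) == 0)) ->
  (\sum_e `|w e| * Num.sqrt (c e) * `|grad q e|) ^+ 2 <=
  (\sum_e w e ^+ 2 * ((q (tgt e) + q (src e)) / 2)) *
  energy q (fun x => ln (q x)).
Proof.
move=> q0 qz.
have key e : grad q e ^+ 2 <=
    (q (tgt e) + q (src e)) / 2 * (grad q e * grad (fun x => ln (q x)) e).
  have [qs|qs] := eqVneq (q (src e)) 0.
    have /eqP qt : q (tgt e) == 0 by rewrite -qz qs.
    by rewrite /edge_diff qs qt subrr expr0n /= !mul0r mulr0.
  have qt : q (tgt e) != 0 by rewrite -qz.
  by apply: sqr_sub_le_ln; rewrite lt_neqAle eq_sym ?qs ?qt q0.
have a0 e : 0 <= (q (tgt e) + q (src e)) / 2 by rewrite divr_ge0 ?addr_ge0.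
apply: CauchySchwarz_sum => e.
- by rewrite mulr_ge0 ?sqr_ge0.
- by apply: mulr_ge0; [exact: ltW | exact: grad_mul_ln_ge0].
- rewrite !exprMn !real_normK ?num_real //.
  rewrite (sqr_sqrtr (ltW (c_gt0 e))).
  have := key e; rewrite -(ler_pM2l (c_gt0 e)) => h.
  have := ler_wpM2l (sqr_ge0 (w e)) h; lra.
Qed.

End HeatFlow.

(** * Heat kernels as matrices: existence, semigroup law, symmetry, telescoping *)

Section HeatKernel.
Variables (R : realType) (n m : nat) (src tgt : 'I_m -> 'I_n).
Variables (c : 'I_m -> R) (pi : 'I_n -> R) (d : R).

Local Notation B := (incidence R src tgt).
Local Notation L := (laplacian src tgt c).
Local Notation grad := (edge_diff src tgt).
Local Notation energy := (energy src tgt c).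
Local Notation heat_step := (heat_step src tgt c pi d).
Local Notation Dpi := (diag_mx (\row_x pi x)).
Local Notation Dinv := (diag_mx (\row_x (pi x)^-1)).
Local Notation T := (Dpi + d *: L).

Lemma sum_incidence (f : 'I_n -> R) e : \sum_x B e x * f x = grad f e.
Proof.
under eq_bigr do rewrite mxE mulrBl !mulr_natl !mulrb.
by rewrite sumrB -!big_mkcond /= !big_pred1_eq.
Qed.

Lemma mul_incidence k (M : 'M[R]_(n, k)) e z :
  (B *m M) e z = grad (fun x => M x z) e.
Proof. by rewrite mxE sum_incidence. Qed.

Lemma mul_tr_incidence k (M : 'M[R]_(k, n)) z e :
  (M *m B^T) z e = grad (fun x => M z x) e.
Proof. by rewrite mxE -sum_incidence; apply: eq_bigr => x _; rewrite mxE mulrC. Qed.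

(** Summation by parts, which links the matrix [L] to the Dirichlet form. *)
Lemma sum_laplacian (v : 'cV[R]_n) (f : 'I_n -> R) :
  \sum_x (L *m v) x 0 * f x = energy (fun x => v x 0) f.
Proof.
rewrite /laplacian -!mulmxA; set y := _ *m (B *m v).
have yE e : y e 0 = c e * grad (fun x => v x 0) e.
  rewrite mxE (bigD1 e) //= big1 => [|i /negPf ie].
    by rewrite addr0 mxE eqxx mul1r mul_incidence.
  by rewrite mxE eq_sym ie !mul0r.
under eq_bigr do rewrite mxE mulr_suml.
rewrite exchange_big; apply: eq_bigr => e _ /=.
rewrite mulrA -yE -sum_incidence mulr_sumr; apply: eq_bigr => x _.
by rewrite mxE; ring.
Qed.

Lemma trmx_laplacian : L^T = L.
Proof.
rewrite /laplacian !trmx_mul trmxK mulmxA; congr (_ *m _ *m _).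
by apply/matrixP => e f; rewrite !mxE; case: eqVneq => [->|]; rewrite ?mul0r.
Qed.

Lemma heat_step_of_mx (p q : 'cV[R]_n) : T *m q = Dpi *m p ->
  heat_step (fun x => p x 0) (fun x => q x 0).
Proof.
move=> Tq f; rewrite -sum_laplacian mulr_sumr -big_split /=.
apply: eq_bigr => x _; move/matrixP: Tq => /(_ x 0).
rewrite mulmxDl -scalemxAl !mul_diag_mx; move: (L *m q) => y.
by rewrite !mxE => <-; rewrite mulrDl mulrA.
Qed.

Hypotheses (c_gt0 : forall e, 0 < c e) (pi_gt0 : forall x, 0 < pi x).
Hypothesis d_gt0 : 0 < d.

(** A null vector is one step away from the zero function, and the L^2 dissipation bound forces it
    to vanish. *)
Lemma heat_unitmx : T \in unitmx.
Proof.
rewrite -row_free_unit; apply: inj_row_free => v /(congr1 trmx).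
rewrite trmx_mul trmx0 !linearD !linearZ /= tr_diag_mx trmx_laplacian => Tv.
have /heat_step_of_mx step : T *m v^T = Dpi *m 0 by rewrite mulmx0.
have := heat_step_norm pi_gt0 step.
under eq_bigr do rewrite mxE expr0n mulr0.
rewrite big1 // sub0r => le0.
have S0 : \sum_x pi x * v^T x 0 ^+ 2 <= 0.
  have := energy_ge0 src tgt c_gt0 (fun x => v^T x 0).
  by move=> /(mulr_ge0 (ltW d_gt0)); lra.
have t0 x : 0 <= pi x * v^T x 0 ^+ 2 by rewrite mulr_ge0 ?sqr_ge0 // ltW.
have : \sum_x pi x * v^T x 0 ^+ 2 == 0 by rewrite eq_le S0 sumr_ge0.
rewrite psumr_eq0 // => /allP v0; apply/rowP => x.
have := v0 x (mem_index_enum x).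
by rewrite !mxE mulf_eq0 gt_eqF //= sqrf_eq0 => /eqP.
Qed.

Definition heat_mx : 'M[R]_n := invmx T *m Dpi.

(** Column z is the density with respect to pi after k steps from the unit mass at z. *)
Definition heat_kernel k : 'M[R]_n := heat_mx ^+ k *m Dinv.

Lemma mul_Dpi_Dinv : Dpi *m Dinv = 1%:M.
Proof.
apply/matrixP => x y; rewrite mul_diag_mx !mxE.
by have [->|_] := eqVneq x y; rewrite ?mulr0n ?mulr0 // mulr1n mulfV // gt_eqF.
Qed.

Lemma mul_Dinv_Dpi : Dinv *m Dpi = 1%:M.
Proof. exact: mulmx1C mul_Dpi_Dinv. Qed.

Lemma heat_step_mx (g : 'cV[R]_n) :
  heat_step (fun x => g x 0) (fun x => (heat_mx *m g) x 0).
Proof. by apply: heat_step_of_mx; rewrite -mulmxA mulKVmx // heat_unitmx. Qed.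

Lemma heat_step_iter k (g : 'cV[R]_n) :
  heat_step (fun x => (heat_mx ^+ k *m g) x 0)
            (fun x => (heat_mx ^+ k.+1 *m g) x 0).
Proof. by rewrite exprS -mulmxE -mulmxA; exact: heat_step_mx. Qed.

Lemma heat_kernelS k : heat_kernel k.+1 = heat_mx *m heat_kernel k.
Proof. by rewrite /heat_kernel exprS mulmxA. Qed.

Lemma heat_kernelD i j :
  heat_kernel (i + j) = heat_kernel i *m Dpi *m heat_kernel j.
Proof.
rewrite /heat_kernel exprD -!mulmxA; congr (_ *m _).
by rewrite !mulmxA mul_Dinv_Dpi mul1mx.
Qed.

(** Reversibility: [T] is symmetric and P = T^-1 pi, so transposing P K_k gives K_k pi T^-1 = K_k pi
    K_1, which is K_(k+1) by the semigroup law. *)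
Lemma trmx_heat_kernel k : (heat_kernel k)^T = heat_kernel k.
Proof.
elim: k => [|k IH]; first by rewrite /heat_kernel expr0 mul1mx tr_diag_mx.
have sw : heat_mx *m heat_kernel k = heat_kernel k *m Dpi *m (heat_mx *m Dinv).
  by rewrite -heat_kernelS -[k.+1]addn1 heat_kernelD [heat_kernel 1]/heat_kernel expr1.
rewrite heat_kernelS trmx_mul IH sw /heat_mx trmx_mul tr_diag_mx -!mulmxA.
rewrite mul_Dpi_Dinv mulmx1 trmx_inv.
by rewrite linearD linearZ /= tr_diag_mx trmx_laplacian.
Qed.

Lemma heat_step_kernel k z :
  heat_step (fun x => heat_kernel k x z) (fun x => heat_kernel k.+1 x z).
Proof.
have colK j : (fun x => heat_kernel j x z) = fun x => col z (heat_kernel j) x 0.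
  by apply: boolp.funext => x; rewrite [RHS]mxE.
have colS : col z (heat_kernel k.+1) = heat_mx *m col z (heat_kernel k).
  by rewrite heat_kernelS !colE mulmxA.
by rewrite !colK colS; exact: heat_step_mx.
Qed.

Lemma heat_kernel_ge0 k x z : 0 <= heat_kernel k x z.
Proof.
elim: k x => [|k IH] x.
  rewrite /heat_kernel expr0 mul1mx !mxE.
  by have [_|_] := eqVneq x z; rewrite ?mulr1n ?mulr0n // invr_ge0 ltW.
exact: (heat_step_ge0 c_gt0 pi_gt0 d_gt0 (heat_step_kernel k z)).
Qed.

Lemma heat_kernel0 x z : heat_kernel 0 x z = (x == z)%:R / pi x.
Proof.
by rewrite /heat_kernel expr0 mul1mx !mxE mulr_natl.
Qed.

Lemma heat_kernel_mass k z : \sum_x pi x * heat_kernel k x z = 1.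
Proof.
elim: k => [|k IH]; last by rewrite (heat_step_mass (heat_step_kernel k z)).
rewrite (bigD1 z) //= big1 => [|x /negPf xz].
  by rewrite heat_kernel0 eqxx mul1r mulfV ?addr0 // gt_eqF.
by rewrite heat_kernel0 xz mul0r mulr0.
Qed.

(** Here [heat_mx *m Dinv] is the inverse of [T], and d L = T - pi. *)
Lemma heat_mx_mul : heat_mx *m Dinv *m (d *: L) = 1 - heat_mx.
Proof.
have <- : heat_mx *m Dinv *m T = 1.
  rewrite /heat_mx -[_ *m Dpi *m Dinv]mulmxA mul_Dpi_Dinv mulmx1 mulVmx //.
  exact: heat_unitmx.
by rewrite mulmxDr -[_ *m _ *m Dpi]mulmxA mul_Dinv_Dpi mulmx1 addrAC subrr add0r.
Qed.

(** Telescoping of K_(k+1) d L = P^k - P^(k+1): d times the partial sum inverts L from the left up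
    to the power P^K. *)
Lemma sum_heat_kernel K :
  (\sum_(k < K) heat_kernel k.+1) *m (d *: L) = 1 - heat_mx ^+ K.
Proof.
elim: K => [|K IH]; first by rewrite big_ord0 mul0mx expr0 subrr.
rewrite big_ord_recr mulmxDl IH /=.
have -> : heat_kernel K.+1 *m (d *: L) = heat_mx ^+ K - heat_mx ^+ K.+1.
  rewrite /heat_kernel exprSr -!mulmxE -(mulmxA _ heat_mx) -(mulmxA (heat_mx ^+ K)).
  by rewrite heat_mx_mul mulmxBr mulmx1.
by rewrite addrA subrK.
Qed.

End HeatKernel.

(** * The weighted sum of absolute edge entries and its bound by squares *)

Section ElectricalPairing.
Variables (R : realType) (n m : nat) (src tgt : 'I_m -> 'I_n).
Variables (c : 'I_m -> R) (pi : 'I_n -> R) (w : 'cV[R]_m).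

Local Notation B := (incidence R src tgt).
Local Notation L := (laplacian src tgt c).
Local Notation Dinv := (diag_mx (\row_x (pi x)^-1)).
Local Notation Dpi := (diag_mx (\row_x pi x)).
Local Notation grad := (edge_diff src tgt).
Local Notation energy := (energy src tgt c).
Local Notation mu := (mu_w src tgt w).
Local Notation S := (sqnorm w).

Definition flow_wt e : R := `|w e 0| * Num.sqrt (c e).

(** At M = L^+ this is |w|^T |Pi| |w| with entrywise absolute values; being a seminorm in M, it can
    be bounded kernel by kernel. *)
Definition pairing (M : 'M[R]_n) : R :=
  \sum_e \sum_f flow_wt e * flow_wt f * `|(B *m M *m B^T) e f|.

Definition grad_sq (M : 'M[R]_n) : R :=
  \sum_z pi z * (\sum_e flow_wt e * `|(B *m M) e z|) ^+ 2.

Lemma pairing_entry (M N : 'M[R]_n) e f : (B *m (M *m N) *m B^T) e f =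
  grad (fun x => (M *m (N *m col f B^T)) x 0) e.
Proof. by rewrite -mul_incidence colE !mulmxA -colE [RHS]mxE. Qed.

Lemma flow_wt_ge0 e : 0 <= flow_wt e.
Proof. by rewrite mulr_ge0 ?normr_ge0 ?sqrtr_ge0. Qed.

Lemma pairingD M N : pairing (M + N) <= pairing M + pairing N.
Proof.
rewrite -big_split; apply: ler_sum => e _; rewrite -big_split; apply: ler_sum => f _ /=.
rewrite -mulrDr; apply: ler_wpM2l; first by apply: mulr_ge0; exact: flow_wt_ge0.
by rewrite mulmxDr mulmxDl mxE ler_normD.
Qed.

Lemma pairingZ a M : 0 <= a -> pairing (a *: M) = a * pairing M.
Proof.
move=> a0; rewrite mulr_sumr; apply: eq_bigr => e _.
rewrite mulr_sumr; apply: eq_bigr => f _.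
by rewrite -scalemxAr -scalemxAl mxE normrM ger0_norm //; ring.
Qed.

Lemma pairing0 : pairing 0 = 0.
Proof.
apply: big1 => e _; apply: big1 => f _.
by rewrite mulmx0 mul0mx mxE normr0 mulr0.
Qed.

Lemma pairing_sum K (M : 'I_K -> 'M[R]_n) :
  pairing (\sum_k M k) <= \sum_k pairing (M k).
Proof.
elim/big_ind2: _ => [|x1 x2 y1 y2 h1 h2|//]; first by rewrite pairing0.
by apply: le_trans (pairingD _ _) _; rewrite lerD.
Qed.

Hypotheses (c_gt0 : forall e, 0 < c e) (pi_gt0 : forall x, 0 < pi x).

Lemma grad_sq_ge0 M : 0 <= grad_sq M.
Proof. by apply: sumr_ge0 => z _; rewrite mulr_ge0 ?sqr_ge0 // ltW. Qed.

(** Entry (e, f) is the sum over z of pi(z) (B M)(e, z) (B N)(f, z). After the triangle inequality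
    the sums over e and f factor for each z, and 2 x y <= x^2 + y^2 finishes. *)
Lemma pairing_mul_le (M N : 'M[R]_n) : N^T = N ->
  pairing (M *m Dpi *m N) <= (grad_sq M + grad_sq N) / 2.
Proof.
move=> Nsym.
pose a e z := `|(B *m M) e z|; pose b e z := `|(B *m N) e z|.
have entry_le e f : `|(B *m (M *m Dpi *m N) *m B^T) e f| <=
      \sum_z pi z * (a e z * b f z).
  have -> : B *m (M *m Dpi *m N) *m B^T = (B *m M) *m Dpi *m (B *m N)^T.
    by rewrite trmx_mul Nsym !mulmxA.
  rewrite mul_mx_diag mxE; apply: le_trans (ler_norm_sum _ _ _) _.
  apply: ler_sum => z _; rewrite [X in X * _]mxE [X in _ * X]mxE.
  rewrite [X in _ * X * _]mxE !normrM /a /b (gtr0_norm (pi_gt0 z)).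
  by rewrite le_eqVlt; apply/orP; left; apply/eqP; ring.
have -> : (grad_sq M + grad_sq N) / 2 = \sum_z pi z *
    (((\sum_e flow_wt e * a e z) ^+ 2 + (\sum_e flow_wt e * b e z) ^+ 2) / 2).
  rewrite -big_split mulr_suml; apply: eq_bigr => z _ /=.
  by rewrite -mulrDr mulrA.
apply: le_trans (_ : \sum_z pi z *
    ((\sum_e flow_wt e * a e z) * (\sum_f flow_wt f * b f z)) <= _).
  apply: le_trans (_ : \sum_e \sum_f \sum_z pi z *
     (flow_wt e * a e z * (flow_wt f * b f z)) <= _).
    apply: ler_sum => e _; apply: ler_sum => f _.
    apply: le_trans (ler_wpM2l _ (entry_le e f)) _;
      first by apply: mulr_ge0; exact: flow_wt_ge0.
    rewrite mulr_sumr le_eqVlt; apply/orP; left; apply/eqP.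
    by apply: eq_bigr => z _; ring.
  under eq_bigr do rewrite exchange_big.
  rewrite exchange_big; apply: ler_sum => z _.
  rewrite mulr_suml mulr_sumr le_eqVlt; apply/orP; left; apply/eqP.
  apply: eq_bigr => e _; rewrite !mulr_sumr.
  by apply: eq_bigr => f _; ring.
apply: ler_sum => z _; apply: ler_wpM2l; first exact: ltW.
move: (\sum_e _) (\sum_f _) => x y; have := sqr_ge0 (x - y); lra.
Qed.

(** * The vertex measure mu_w and the entropy budget of the flow *)

Hypothesis no_loop : forall e, src e != tgt e.
Hypothesis w_nz : w != 0.

Lemma sqnorm_gt0 : 0 < S.
Proof.
have t0 e : 0 <= w e 0 ^+ 2 by rewrite sqr_ge0.
rewrite lt_neqAle sumr_ge0 // andbT eq_sym; apply: contra w_nz.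
rewrite psumr_eq0 // => /allP w0; apply/eqP/colP => e.
by have := w0 e (mem_index_enum e); rewrite sqrf_eq0 mxE => /eqP.
Qed.

(** Double counting. As the ends of an edge differ, the disjunction in [mu_w] is a sum of two
    indicators. *)
Lemma sum_mu_w (q : 'I_n -> R) :
  S * \sum_x mu x * q x = \sum_e w e 0 ^+ 2 * ((q (tgt e) + q (src e)) / 2).
Proof.
have Sn : S != 0 by rewrite gt_eqF // sqnorm_gt0.
have muE x : S * (mu x * q x) =
    \sum_e w e 0 ^+ 2 * ((x == tgt e)%:R * q x + (x == src e)%:R * q x) / 2.
  rewrite /mu_w big_mkcond /= -mulr_suml.
  have -> : S * ((2 * S)^-1 *
      (\sum_e (if (src e == x) || (tgt e == x) then w e 0 ^+ 2 else 0)) * q x)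
    = (\sum_e (if (src e == x) || (tgt e == x) then w e 0 ^+ 2 else 0)) * q x / 2.
    by field.
  rewrite mulr_suml; congr (_ / _); apply: eq_bigr => e _.
  rewrite ![x == _]eq_sym; have := no_loop e.
  have [<-|_] := eqVneq (src e) x; have [<-|_] := eqVneq (tgt e) _ => //=;
    rewrite ?eqxx // => _; ring.
rewrite mulr_sumr; under eq_bigr do rewrite muE.
rewrite exchange_big; apply: eq_bigr => e _ /=.
rewrite -mulr_suml -mulr_sumr mulrA big_split /=; congr (_ * (_ + _) / _).
  by under eq_bigr do rewrite mulr_natl mulrb; rewrite -big_mkcond /= big_pred1_eq.
by under eq_bigr do rewrite mulr_natl mulrb; rewrite -big_mkcond /= big_pred1_eq.
Qed.

Lemma mu_w_ge0 x : 0 <= mu x.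
Proof.
apply: mulr_ge0; first by rewrite invr_ge0 mulr_ge0 // ltW // sqnorm_gt0.
by apply: sumr_ge0 => e _; rewrite sqr_ge0.
Qed.

Lemma sum_mu_w1 : \sum_x mu x = 1.
Proof.
apply: (mulfI (lt0r_neq0 sqnorm_gt0)); rewrite mulr1.
have := sum_mu_w (fun=> 1); under eq_bigr do rewrite mulr1.
by move=> ->; apply: eq_bigr => e _; field.
Qed.

Hypothesis mu_le_pi : forall x, mu x <= pi x.
Variable d : R.
Hypothesis d_gt0 : 0 < d.

Local Notation K := (heat_kernel src tgt c pi d).
Local Notation P := (heat_mx src tgt c pi d).
Local Notation V := (\sum_x pi x).

Lemma grad_sq_kernel_le k : d * grad_sq (K k.+1) <=
  S * \sum_z pi z * (ent pi (fun x => K k x z) - ent pi (fun x => K k.+1 x z)).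
Proof.
rewrite !mulr_sumr; apply: ler_sum => z _.
have K0 j x : 0 <= K j x z by apply: heat_kernel_ge0.
have step := heat_step_kernel src tgt c_gt0 pi_gt0 d_gt0 k z.
have Eent := heat_step_ent c_gt0 pi_gt0 d_gt0 step (K0 k).
have [_ z0] := heat_step_eq0 c_gt0 pi_gt0 d_gt0 step (K0 k).
have := sqr_sum_grad_le c_gt0 (fun e => w e 0) (K0 k.+1) z0.
rewrite /= -(sum_mu_w (fun x => K k.+1 x z)); set G := energy _ _ => Gle.
(* Since mu <= pi, the mass 1 with respect to pi bounds the mu-average; the first Cauchy-Schwarz
   factor is then at most S. *)
have M1 : \sum_x mu x * K k.+1 x z <= 1.
  rewrite -(heat_kernel_mass src tgt c_gt0 pi_gt0 d_gt0 k.+1 z).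
  by apply: ler_sum => x _; rewrite ler_wpM2r.
have S0 := ltW sqnorm_gt0.
have -> : \sum_e flow_wt e * `|(B *m K k.+1) e z| =
    \sum_e flow_wt e * `|grad (fun x => K k.+1 x z) e|.
  by apply: eq_bigr => e _; rewrite mul_incidence.
have G0 : 0 <= G.
  apply: sumr_ge0 => e _; apply: mulr_ge0; first exact: ltW.
  exact: grad_mul_ln_ge0 (K0 k.+1) (z0 e).
have -> : S * (pi z * (ent pi (fun x => K k x z) - ent pi (fun x => K k.+1 x z)))
  = pi z * (S * (ent pi (fun x => K k x z) - ent pi (fun x => K k.+1 x z))) by ring.
rewrite mulrCA; apply: ler_wpM2l; first exact: ltW.
apply: le_trans (ler_wpM2l S0 Eent); rewrite [leRHS]mulrCA.
apply: ler_wpM2l; first exact: ltW.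
apply: (le_trans Gle); apply: ler_wpM2r => //.
by rewrite ler_piMr.
Qed.

(** The entropy drops telescope: from z the flow starts at entropy - ln pi(z) and stays above - ln
    V. *)
Lemma sum_grad_sq_kernel_le N : d * \sum_(k < N) grad_sq (K k.+1) <=
  S * (V * ln V - \sum_x pi x * ln (pi x)).
Proof.
have telescope : d * \sum_(k < N) grad_sq (K k.+1) <=
    S * \sum_z pi z * (ent pi (fun x => K 0 x z) - ent pi (fun x => K N x z)).
  elim: N => [|N IH].
    rewrite big_ord0 mulr0 big1 ?mulr0 // => z _.
    by rewrite subrr mulr0.
  rewrite big_ord_recr mulrDr; apply: le_trans (lerD IH (grad_sq_kernel_le N)) _.
  rewrite -mulrDr -big_split le_eqVlt; apply/orP; left; apply/eqP; congr (_ * _).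
  by apply: eq_bigr => z _ /=; ring.
apply: (le_trans telescope); apply: ler_wpM2l; first exact: ltW sqnorm_gt0.
rewrite mulr_suml -sumrB; apply: ler_sum => z _.
rewrite -mulrBr; apply: ler_wpM2l; first exact: ltW.
rewrite [leRHS]addrC; apply: lerD; last first.
  rewrite lerNl; apply: ent_ge => // [x|]; first exact: heat_kernel_ge0.
  exact: heat_kernel_mass.
rewrite /ent (bigD1 z) //= big1 => [|x /negPf xz].
  by rewrite heat_kernel0 eqxx mul1r mulrA mulfV ?gt_eqF // mul1r addr0 lnV ?posrE.
by rewrite heat_kernel0 xz !mul0r mulr0.
Qed.

(** Split K_(2i+1) = K_i pi K_(i+1) and K_(2i+2) = K_(i+1) pi K_(i+1). For 0 < k < N, [grad_sq] of
    K_k collects 1/2 + 1 + 1/2 = 2, the factor 2 of the theorem; the ends k = 0 and k = N give the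
    correction term. *)
Lemma sum_pairing_kernel_le N : \sum_(k < N.*2) pairing (K k.+1) <=
  (grad_sq (K 0) - grad_sq (K N)) / 2 + 2 * \sum_(k < N) grad_sq (K k.+1).
Proof.
elim: N => [|N IH]; first by rewrite !big_ord0 subrr mul0r mulr0 addr0.
rewrite doubleS !big_ord_recr /=.
have sym j : (K j)^T = K j by apply: trmx_heat_kernel.
have odd_le : pairing (K N.*2.+1) <= (grad_sq (K N) + grad_sq (K N.+1)) / 2.
  by rewrite -addnn -addnS heat_kernelD //; apply: pairing_mul_le.
have even_le : pairing (K N.*2.+2) <= (grad_sq (K N.+1) + grad_sq (K N.+1)) / 2.
  by rewrite -doubleS -addnn heat_kernelD //; apply: pairing_mul_le.
lra.
Qed.

(** * From heat kernels to the pseudo-inverse *)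

Variable Lp : 'M[R]_n.
Hypothesis hLp : is_MP_pinv L Lp.

(** Y = 1 - L L^+ is symmetric and kills L, so the columns of Y^T have zero energy and are constant
    across every edge. *)
Lemma laplacian_pinv_incidence : L *m Lp *m B^T = B^T.
Proof.
have [LXL _ LXsym _] := hLp; pose Y := 1%:M - L *m Lp.
have YL : Y *m L = 0 by rewrite mulmxBl mul1mx LXL subrr.
have Ysym : Y^T = Y by rewrite linearB /= trmx1 LXsym.
suff : Y *m B^T = 0 by move/eqP; rewrite mulmxBl mul1mx subr_eq0 => /eqP <-.
apply/matrixP => x e; rewrite mul_tr_incidence mxE.
have LY : L *m Y^T = 0.
  by rewrite -[L in L *m _](trmx_laplacian src tgt c) -trmx_mul YL trmx0.
pose v := col x Y^T; have E0 : energy (fun y => v y 0) (fun y => v y 0) = 0.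
  rewrite -sum_laplacian /v colE mulmxA LY mul0mx.
  by apply: big1 => y _; rewrite mxE mul0r.
have t0 i : 0 <= c i * (grad (fun y => v y 0) i * grad (fun y => v y 0) i).
  by rewrite -expr2 mulr_ge0 ?sqr_ge0 // ltW.
move/eqP: E0; rewrite psumr_eq0 // => /allP/(_ e (mem_index_enum e)) /=.
rewrite mulf_eq0 gt_eqF //= -expr2 sqrf_eq0 => /eqP.
by rewrite /edge_diff /v !mxE.
Qed.

(** Multiplying the telescoped identity by L^+ B^T and using L L^+ B^T = B^T gives L^+ = d sum K_k +
    P^N L^+ on edge vectors. *)
Lemma pairing_pinv_le N :
  pairing Lp <= d * \sum_(k < N) pairing (K k.+1) + pairing (P ^+ N *m Lp).
Proof.
have eqB : (d *: (\sum_(k < N) K k.+1) + P ^+ N *m Lp) *m B^T = Lp *m B^T.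
  rewrite mulmxDl -{1}laplacian_pinv_incidence -mulmxA.
  rewrite [d *: _ *m _]mulmxA -scalemxAl scalemxAr (sum_heat_kernel src tgt c_gt0) //.
  by rewrite mulmxBl mul1mx mulmxA subrK.
have -> : pairing Lp = pairing (d *: (\sum_(k < N) K k.+1) + P ^+ N *m Lp).
  by apply: eq_bigr => e _; apply: eq_bigr => f _; rewrite -!mulmxA eqB.
apply: le_trans (pairingD _ _) _; rewrite lerD2r pairingZ ?(ltW d_gt0) //.
by apply: ler_wpM2l; [exact: ltW | exact: pairing_sum].
Qed.

(** Each step dissipates 2 d times its energy, and the last energy is the smallest; this yields
    decay of order 1/N. *)
Lemma energy_heat_iter (g : 'cV[R]_n) N :
  2 * d * (N%:R * energy (fun x => (P ^+ N *m g) x 0) (fun x => (P ^+ N *m g) x 0))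
  <= \sum_x pi x * g x 0 ^+ 2 - \sum_x pi x * (P ^+ N *m g) x 0 ^+ 2.
Proof.
elim: N => [|N IH]; first by rewrite expr0 mul1mx mul0r mulr0 subrr.
have step := heat_step_iter src tgt c_gt0 pi_gt0 d_gt0 N g.
have En := heat_step_norm pi_gt0 step.
have Ed := heat_step_energy c_gt0 pi_gt0 d_gt0 step.
have dN : 0 <= 2 * d * N%:R by rewrite !mulr_ge0 // ltW.
have := ler_wpM2l dN Ed; rewrite -natr1; lra.
Qed.

(** Every entry tends to 0 by the energy decay. The exponent is even because [sum_pairing_kernel_le]
    treats kernels in pairs. *)
Lemma pairing_tail eps : 0 < eps -> exists N, pairing (P ^+ N.*2 *m Lp) <= eps.
Proof.
move=> eps0.
pose U := \sum_e \sum_f flow_wt e * flow_wt f.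
pose Q f := \sum_x pi x * (Lp *m col f B^T) x 0 ^+ 2.
pose C := \sum_e \sum_f flow_wt e * flow_wt f * (Q f / (2 * d * c e)).
have U0 : 0 <= U.
  by do 2![apply: sumr_ge0 => ? _]; apply: mulr_ge0; exact: flow_wt_ge0.
have Q0 f : 0 <= Q f.
  by apply: sumr_ge0 => x _; rewrite mulr_ge0 ?sqr_ge0 // ltW.
have dc e : 0 < 2 * d * c e by rewrite !mulr_gt0.
(* The square bound becomes linear through |y| <= t + y^2 / t; this t makes t U <= eps / 2, and N
   below makes the other part at most eps / 2. *)
pose t := eps / (2 * (U + 1)).
have t0 : 0 < t by rewrite divr_gt0 // mulr_gt0 // ltr_wpDl.
have [N Nle] : exists N, C / t <= N.+1%:R * (eps / 2).
  exists (Num.truncn (C / t / (eps / 2))).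
  rewrite -ler_pdivrMr ?divr_gt0 //.
  exact: ltW (truncnS_gt _).
exists N.+1; set k := N.+1.*2.
have kN : N.+1%:R <= k%:R :> R by rewrite ler_nat /k -addnn leq_addr.
have k0 : 0 < k%:R :> R by rewrite ltr0n.
have entry e f : `|(B *m (P ^+ k *m Lp) *m B^T) e f| <=
    t + Q f / (2 * d * c e) / t / k%:R.
  set y := _ e f.
  pose g := P ^+ k *m (Lp *m col f B^T).
  have yE : y = grad (fun x => g x 0) e := pairing_entry _ _ e f.
  have y2 : y ^+ 2 <= Q f / (2 * d * c e) / k%:R.
    have := energy_heat_iter (Lp *m col f B^T) k; rewrite -/g -/(Q f).
    set E := energy _ _ => Ele.
    have cE : c e * y ^+ 2 <= E.
      rewrite /E /energy (bigD1 e) //= -yE expr2 lerDl.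
      by apply: sumr_ge0 => i _; rewrite -expr2 mulr_ge0 ?sqr_ge0 // ltW.
    have dk : 0 <= 2 * d * k%:R by rewrite !mulr_ge0 // ltW.
    have := ler_wpM2l dk cE.
    have : 0 <= \sum_x pi x * g x 0 ^+ 2.
      by apply: sumr_ge0 => x _; rewrite mulr_ge0 ?sqr_ge0 // ltW.
    rewrite ler_pdivlMr // ler_pdivlMr //; lra.
  have y2t : y ^+ 2 / t <= Q f / (2 * d * c e) / t / k%:R.
    by rewrite [leRHS]mulrAC ler_pM2r ?invr_gt0.
  apply: le_trans (lerD (lexx t) y2t).
  rewrite -(ler_pM2l t0) mulrDr [t * (_ / t)]mulrC divfK ?gt_eqF //.
  rewrite -(real_normK (num_real y)); have := sqr_ge0 (`|y| - t); have := sqr_ge0 t.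
  have := mulr_ge0 (ltW t0) (normr_ge0 y); lra.
apply: le_trans (_ : t * U + C / t / k%:R <= _).
  rewrite /U /C mulr_sumr !mulr_suml -big_split; apply: ler_sum => e _ /=.
  rewrite mulr_sumr !mulr_suml -big_split; apply: ler_sum => f _ /=.
  have u0 : 0 <= flow_wt e * flow_wt f by apply: mulr_ge0; exact: flow_wt_ge0.
  by have := ler_wpM2l u0 (entry e f); lra.
have tU : t * U <= eps / 2.
  rewrite /t mulrAC ler_pdivrMr ?mulr_gt0 ?ltr_wpDl //; nra.
have Ck : C / t / k%:R <= eps / 2.
  rewrite ler_pdivrMr //; apply: (le_trans Nle); rewrite mulrC.
  by apply: ler_wpM2l => //; rewrite divr_ge0 // ltW.
lra.
Qed.

(** N goes to infinity at fixed d; the last term is what remains of the boundary term at k = 0 and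
    is linear in d. *)
Lemma pairing_pinv_le_step :
  pairing Lp <= 2 * (S * (V * ln V - \sum_x pi x * ln (pi x)))
                + d * (grad_sq Dinv / 2).
Proof.
apply/ler_addgt0Pr => eps /pairing_tail[N tail].
apply: le_trans (pairing_pinv_le N.*2) _.
have := sum_grad_sq_kernel_le N.
have := ler_wpM2l (ltW d_gt0) (sum_pairing_kernel_le N).
have -> : K 0 = Dinv by rewrite /heat_kernel expr0 mul1mx.
have := mulr_ge0 (ltW d_gt0) (grad_sq_ge0 (K N)).
lra.
Qed.
End ElectricalPairing.

(** * Removing the step size and the shift *)

(** Passage to the limit with a linear error, used both for the step size d and for the shift s. *)
Lemma ler_addgt0M (R : realType) (a b C : R) :
  (forall t, 0 < t <= 1 -> a <= b + t * C) -> a <= b.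
Proof.
move=> h; apply/ler_addgt0Pr => eps eps0.
have C1 : 0 < `|C| + 1 by rewrite ltr_wpDl.
pose t := Num.min 1 (eps / (`|C| + 1)).
have t0 : 0 < t by rewrite lt_min ltr01 divr_gt0.
have t1 : t <= 1 by rewrite ge_min lexx.
apply: le_trans (h t _) _; first by rewrite t0 t1.
rewrite lerD2l; apply: le_trans (_ : t * (`|C| + 1) <= _).
  by apply: ler_wpM2l (ltW t0) _ _ _; have := ler_norm C; lra.
by rewrite -ler_pdivlMr // ge_min lexx orbT.
Qed.

(** As V = 1 + n s^2, V ln V is of order s. At each vertex - pi ln pi splits into a mu part, where
    ln pi >= ln mu, and an s^2 part, at most 2 s by [sqr_xlnx_ge]. *)
Lemma entropy_shift_le (R : realType) n (mu pi : 'I_n -> R) s :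
  (forall x, 0 <= mu x) -> \sum_x mu x = 1 -> 0 < s <= 1 ->
  (forall x, pi x = mu x + s ^+ 2) ->
  (\sum_x pi x) * ln (\sum_x pi x) - \sum_x pi x * ln (pi x)
  <= entropy mu + s * ((n%:R + 1) * n%:R + 2 * n%:R).
Proof.
move=> mu0 mu1 /andP[s0 s1] piE; set V := \sum_x pi x.
have s2 : 0 < s ^+ 2 by rewrite exprn_gt0.
have n0 : 0 <= n%:R :> R by rewrite ler0n.
have VE : V = 1 + n%:R * s ^+ 2.
  rewrite /V (eq_bigr _ (fun x _ => piE x)) big_split /= mu1.
  by rewrite sumr_const card_ord mulr_natl.
have s2s : s ^+ 2 <= s by rewrite expr2 ler_piMr // ltW.
have VlnV : V * ln V <= s * ((n%:R + 1) * n%:R).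
  have ns0 : 0 <= n%:R * s ^+ 2 by rewrite mulr_ge0 // ltW.
  have lnV : ln V <= n%:R * s ^+ 2 by rewrite VE le_ln1Dx; lra.
  have V0 : 0 <= V by lra.
  have nss : n%:R * s ^+ 2 <= n%:R * s by apply: ler_wpM2l.
  have ns : n%:R * s <= n%:R by rewrite ler_piMr.
  apply: le_trans (_ : (n%:R + 1) * (n%:R * s) <= _); last by lra.
  apply: le_trans (ler_wpM2l V0 lnV) _; apply: ler_pM => //; lra.
suff : - \sum_x pi x * ln (pi x) <= entropy mu + s * (2 * n%:R) by lra.
have -> : s * (2 * n%:R) = \sum_(x < n) 2 * s.
  by rewrite sumr_const card_ord -[RHS]mulr_natl; ring.
rewrite /entropy -!sumrN -big_split; apply: ler_sum => x _ /=.
have pi_ge : s ^+ 2 <= pi x by rewrite piE lerDr.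
have pi0 : 0 < pi x := lt_le_trans s2 pi_ge.
have ln_s : ln (s ^+ 2) <= ln (pi x) by rewrite ler_ln ?posrE.
have h1 : - (s ^+ 2 * ln (pi x)) <= 2 * s.
  apply: le_trans (sqr_xlnx_ge s0); rewrite lerN2.
  by apply: ler_wpM2l => //; exact: ltW.
have h2 : - (mu x * ln (pi x)) <= - (if mu x == 0 then 0 else mu x * ln (mu x)).
  have [->|mun] := eqVneq (mu x) 0; first by rewrite mul0r.
  have mup : 0 < mu x by rewrite lt_neqAle eq_sym mun mu0.
  rewrite lerN2; apply: ler_wpM2l => //.
  by rewrite ler_ln ?posrE // piE lerDl ltW.
by rewrite {1}piE mulrDl opprD lerD.
Qed.

Lemma norm_quad_le_pairing (R : realType) n m (src tgt : 'I_m -> 'I_n)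
  (c : 'I_m -> R) (Lp : 'M[R]_n) (w : 'cV[R]_m) :
  `|(w^T *m abs_mx (Pi_mx src tgt c Lp) *m w) 0 0| <= pairing src tgt c w Lp.
Proof.
have sqE : sqrt_cond_mx c = diag_mx (\row_e Num.sqrt (c e)).
  apply/matrixP => e f; rewrite !mxE mulr_natl.
  by case: eqVneq => [->|_]; rewrite ?mulr1n ?mulr0n.
have PiE e f : Pi_mx src tgt c Lp e f = Num.sqrt (c e) *
    (incidence R src tgt *m Lp *m (incidence R src tgt)^T) e f * Num.sqrt (c f).
  rewrite /Pi_mx sqE mul_mx_diag mxE -!mulmxA mul_diag_mx !mulmxA.
  by rewrite [X in X * _]mxE [X in X * _ * _]mxE [X in _ * X]mxE.
rewrite -mulmxA mxE; apply: le_trans (ler_norm_sum _ _ _) _.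
apply: ler_sum => e _; rewrite !mxE mulr_sumr.
apply: le_trans (ler_norm_sum _ _ _) _; apply: ler_sum => f _.
rewrite mxE PiE !(normrM, normr_id) !(ger0_norm (sqrtr_ge0 _)) /flow_wt.
by rewrite le_eqVlt; apply/orP; left; apply/eqP; ring.
Qed.

Theorem theorem1p4 (R : realType) (n m : nat) (src tgt : 'I_m -> 'I_n)
  (no_loop : forall e, src e != tgt e)
  (c : 'I_m -> R) (c_pos : forall e, 0 < c e)
  (Lp : 'M[R]_n) (hLp : is_MP_pinv (laplacian src tgt c) Lp)
  (w : 'cV[R]_m) (w_nz : w != 0) :
  `| ((w^T *m abs_mx (Pi_mx src tgt c Lp) *m w) 0 0) |
    <= 2 * entropy (mu_w src tgt w) * sqnorm w.
Proof.
apply: le_trans (norm_quad_le_pairing _ _ _ _ _) _.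
have S0 := sqnorm_gt0 w_nz; have mu0 := mu_w_ge0 src tgt w_nz.
have mu1 := sum_mu_w1 no_loop w_nz.
apply: (@ler_addgt0M R _ _
  (2 * sqnorm w * ((n%:R + 1) * n%:R + 2 * n%:R))) => s s01.
have [s0 _] := andP s01; have s2 : 0 < s ^+ 2 by rewrite exprn_gt0.
pose pi x := mu_w src tgt w x + s ^+ 2.
have pi_gt0 x : 0 < pi x by rewrite ltr_wpDl.
have mu_le_pi x : mu_w src tgt w x <= pi x by rewrite lerDl ltW.
apply: le_trans (_ : 2 * (sqnorm w *
   ((\sum_x pi x) * ln (\sum_x pi x) - \sum_x pi x * ln (pi x))) <= _).
  (* The step size goes to 0 first, at fixed s, since its error term involves pi^-1 and is not
     controlled uniformly in s. *)
  apply: ler_addgt0M => d /andP[d0 _].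
  exact: pairing_pinv_le_step.
have := ler_wpM2l (ltW S0) (entropy_shift_le mu0 mu1 s01 (fun x => erefl (pi x))); lra.
Qed.
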